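(* Let $A$ be a proper unital $*$-ring such that $A_\Sigma\cap-A_\Sigma=\{0\}$. Then there are no non-zero nilpotent elements in the set $(\mathfrak{c}\cup A_+)(\mathfrak{c}\cup A_+)\cup A_{\mathrm{n}}$.
   Context: A $*$-ring is an associative ring with a map $a\mapsto a^*$ satisfying $a^{**}=a$, $(ab)^*=b^*a^*$, $(a+b)^*=a^*+b^*$; it is proper if $a^*a=0$ implies $a=0$. Unital means having a two-sided unit $1$. $A_{\mathrm{n}}=\{a\in A:aa^*=a^*a\}$. $A_\Sigma$ is the set of all finite sums $\sum_{k=1}^n a_k^*a_k$ with $n\geq1$, $a_k\in A$. $A_+=\{a\in A:na\in A_\Sigma\text{ for some positive integer }n\}$. $\mathfrak{r}=\{a\in A:a+a^*\in A_+\}$, and $a\preceq b$ means $b-a\in\mathfrak{r}$. $\mathfrak{c}=\{a\in A:a^*a\preceq na\text{ for some positive integer }n\}$. For subsets $B,C\subseteq A$, $BC=\{bc:b\in B,c\in C\}$. An element $x$ is nilpotent if $x^n=0$ for some positive integer $n$. *)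

(* Defs.v *)
From HB Require Import structures.
From mathcomp Require Import all_boot all_algebra.
From mathcomp Require Import classical_sets.

Set Implicit Arguments.
Unset Strict Implicit.
Unset Printing Implicit Defensive.

Import GRing.Theory.
Local Open Scope classical_set_scope.
Local Open Scope ring_scope.

(* Unital *-rings; the zero ring is allowed, hence PzRing rather than NzRing.
   Commutativity is not assumed. *)
HB.mixin Record PzRing_isStarRing A & GRing.PzRing A := {
  star : A -> A;
  starK : involutive star;
  starM : forall a b : A, star (a * b) = star b * star a;
  starD : {morph star : a b / a + b}
}.

#[short(type="starRingType")]
HB.structure Definition StarRing := {A of PzRing_isStarRing A & GRing.PzRing A}.

Section StarRingDefs.
Variable A : starRingType.
Implicit Types (a b x : A) (B C : set A).

Definition proper_star : Prop := forall a, star a * a = 0 -> a = 0.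

Definition normal_elts : set A := [set a | a * star a = star a * a].

Definition sums_of_squares : set A :=
  [set a | exists n (f : 'I_n -> A),
     (0 < n)%N /\ a = \sum_(k < n) star (f k) * f k].

Definition positive_elts : set A :=
  [set a | exists n, (0 < n)%N /\ sums_of_squares (a *+ n)].

Definition accretive_elts : set A := [set a | positive_elts (a + star a)].

Definition star_le a b : Prop := accretive_elts (b - a).

Definition cone_elts : set A :=
  [set a | exists n, (0 < n)%N /\ star_le (star a * a) (a *+ n)].

Definition opp_set B : set A := [set - b | b in B].

Definition mul_set B C : set A := [set b * c | b in B & c in C].

Definition nilpotent_elt x : Prop := exists n, (0 < n)%N /\ x ^+ n = 0.

End StarRingDefs.

Arguments proper_star A : clear implicits.
Arguments normal_elts A : clear implicits.
Arguments sums_of_squares A : clear implicits.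
Arguments positive_elts A : clear implicits.
Arguments accretive_elts A : clear implicits.
Arguments cone_elts A : clear implicits.

(* Main.v *)
Require Import Defs.
From HB Require Import structures.
From mathcomp Require Import all_boot all_algebra.
From mathcomp Require Import classical_sets.

Import GRing.Theory.
Local Open Scope classical_set_scope.
Local Open Scope ring_scope.

(** Elements are treated like operators on a Hilbert space, with arbitrary ring
    elements [y] in the role of vectors and [star y * b * y] in the role of the
    quadratic form of [b] at [y].  For a positive [b], as for a [b] in
    [cone_elts A], vanishing of this form at [y] already forces [b * y = 0] and
    [star b * y = 0] ([form_definite]).  For positive elements this is because a
    sum of squares vanishes only if each square does ([sum_squares_eq0]).  For
    [b] in the cone, [b + star b] dominates a positive rational multiple of
    [star b * b], which gives [b * y = 0]; and [cone_elts A] is closed under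
    [star] ([cone_star]), because, up to scaling, its elements are those [b] for
    which [1 - b] is a contraction, and the adjoint of a contraction is a
    contraction ([contraction_star]).

    If [b] and [c] are both form definite and [b * c * (b * c * y) = 0], then
    replacing the outermost [b] by [star b] shows that the form of [c] vanishes
    at [b * c * y]; this peels off that [b], and a second round of the same kind
    peels off a [c], leaving [b * c * y = 0].  So for [x = b * c], and
    likewise for normal [x], [x * (x * y) = 0] implies [x * y = 0]: the square of
    [x] has no larger kernel than [x], and such an [x] is nilpotent only if it
    is zero ([nilpotent_eq0]). *)

Lemma star_zmod_morphism (A : starRingType) : zmod_morphism (@star A).
Proof.
move=> a b; apply: (addIr (star b)).
by rewrite -starD !subrK.
Qed.

HB.instance Definition _ (A : starRingType) :=
  GRing.isZmodMorphism.Build A A (@star A) (@star_zmod_morphism A).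

Lemma star1 (A : starRingType) : star (1 : A) = 1.
Proof. by rewrite -[RHS]starK -[star 1 in RHS]mulr1 starM starK mulr1. Qed.

Lemma star_nat (A : starRingType) n : star (n%:R : A) = n%:R.
Proof. by rewrite raddfMn /= star1. Qed.

Lemma star_form (A : starRingType) (b y : A) :
  star (star y * b * y) = star y * star b * y.
Proof. by rewrite !starM starK mulrA. Qed.

(** * Sums of squares and positive elements *)

(** Unlike the indexing by ['I_n] with [0 < n], lists may be empty and
    concatenate; prepending the square of [0] absorbs the non-emptiness. *)
Lemma sums_of_squaresP (A : starRingType) (a : A) :
  sums_of_squares A a <-> exists s : seq A, a = \sum_(x <- s) star x * x.
Proof.
split=> [[n [f [_ ->]]]|[s ->]].
  by exists [seq f k | k <- enum 'I_n]; rewrite big_map big_enum.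
exists (size s).+1, (fun k => nth 0 (0 :: s) k); split=> //.
by rewrite big_ord_recl /= mulr0 add0r (big_nth 0) big_mkord.
Qed.

Lemma sums_of_squaresD (A : starRingType) (a b : A) :
  sums_of_squares A a -> sums_of_squares A b -> sums_of_squares A (a + b).
Proof.
move=> /sums_of_squaresP[s ->] /sums_of_squaresP[t ->].
by apply/sums_of_squaresP; exists (s ++ t); rewrite big_cat.
Qed.

Lemma sums_of_squaresMn (A : starRingType) n (a : A) :
  sums_of_squares A a -> sums_of_squares A (a *+ n).
Proof.
move=> Sa; elim: n => [|n IHn]; last by rewrite mulrS; exact: sums_of_squaresD.
by apply/sums_of_squaresP; exists [::]; rewrite big_nil.
Qed.

Lemma square_sums_of_squares (A : starRingType) (a : A) :
  sums_of_squares A (star a * a).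
Proof. by apply/sums_of_squaresP; exists [:: a]; rewrite big_seq1. Qed.

Lemma conj_sum_squares (A : starRingType) (s : seq A) (y : A) :
  star y * (\sum_(x <- s) star x * x) * y =
  \sum_(x <- s) star (x * y) * (x * y).
Proof.
rewrite mulr_sumr mulr_suml; apply: eq_bigr => x _.
by rewrite starM !mulrA.
Qed.

Lemma positiveD (A : starRingType) (a b : A) :
  positive_elts A a -> positive_elts A b -> positive_elts A (a + b).
Proof.
move=> [m [m0 Sa]] [n [n0 Sb]]; exists (m * n)%N; split; first by rewrite muln_gt0 m0.
rewrite mulrnDl mulrnA [in X in _ + X]mulnC mulrnA.
by apply: sums_of_squaresD; exact: sums_of_squaresMn.
Qed.

Lemma square_positive (A : starRingType) (a : A) :
  positive_elts A (star a * a).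
Proof. by exists 1%N; split=> //; rewrite mulr1n; exact: square_sums_of_squares. Qed.

Lemma positive_conj (A : starRingType) (a y : A) :
  positive_elts A a -> positive_elts A (star y * a * y).
Proof.
move=> [n [n0 /sums_of_squaresP[s Es]]]; exists n; split=> //.
apply/sums_of_squaresP; exists [seq x * y | x <- s].
by rewrite big_map -conj_sum_squares -Es mulrnAr mulrnAl.
Qed.

Lemma positiveMn_inv (A : starRingType) n (a : A) :
  (0 < n)%N -> positive_elts A (a *+ n) -> positive_elts A a.
Proof.
move=> n0 [m [m0 Sa]]; exists (n * m)%N; split; first by rewrite muln_gt0 n0.
by rewrite mulrnA.
Qed.

(** * The cone is closed under the involution *)

(** With [e = d * star d], both [(k - e) ^+ 2] and
    [d * (k - star d * d) * star d = (k - e) * e] are positive,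
    and they add up to [k * (k - e)]. *)
Lemma contraction_star (A : starRingType) k (d : A) :
  (0 < k)%N ->
  positive_elts A (k%:R - star d * d) -> positive_elts A (k%:R - d * star d).
Proof.
move=> k0 Pd; apply: (@positiveMn_inv _ k) => //.
set p := k%:R - d * star d.
have starp : star p = p by rewrite /p raddfB /= star_nat starM starK.
have -> : p *+ k = star p * p + star (star d) * (k%:R - star d * d) * star d.
  have -> : star (star d) * (k%:R - star d * d) * star d = p * (d * star d).
    rewrite starK /p mulrBr mulrBl !mulrBl !mulrA.
    by rewrite -[k%:R * d]commr_nat.
  by rewrite starp -mulrDr subrK mulr_natr.
apply: positiveD; first exact: square_positive.
exact: positive_conj.
Qed.

(** Completing the square: with [v] and [u] equal to [b] and [star b], in either
    order, it says that [n - 2 * b] or its adjoint is bounded by [n] as soon as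
    [u + v] dominates a multiple of [v * u]. *)
Lemma complete_square (A : starRingType) n (u v : A) :
  (n * n)%:R - (n%:R - v *+ 2) * (n%:R - u *+ 2) =
  ((u + v) *+ n - (v * u) *+ 2) *+ 2.
Proof.
rewrite mulrBl !mulrBr natrM !mulr_natl mulr_natr.
rewrite mulrnAl mulrnAr -!mulrnA !opprB.
rewrite mulrnBl mulrnDl mulrnDl -!mulrnA [(2 * n)%N]mulnC.
by rewrite addrCA [X in _ + X]addrC subrK addrC addrA.
Qed.

Lemma coneP (A : starRingType) (b : A) :
  cone_elts A b <-> exists n, (0 < n)%N /\
    positive_elts A ((b + star b) *+ n - (star b * b) *+ 2).
Proof.
have E n : b *+ n - star b * b + star (b *+ n - star b * b) =
           (b + star b) *+ n - (star b * b) *+ 2.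
  by rewrite raddfB raddfMn /= starM starK addrACA -mulrnDl -opprD -mulr2n.
by split=> -[n [n0 H]]; exists n; split=> //; move: H;
   rewrite /star_le /accretive_elts /= E.
Qed.

Lemma cone_star (A : starRingType) (b : A) :
  cone_elts A b -> cone_elts A (star b).
Proof.
move=> /coneP[n [n0 Pb]]; apply/coneP; exists n; split=> //.
pose d : A := n%:R - b *+ 2.
have Ed : star d = n%:R - star b *+ 2 by rewrite raddfB /= star_nat raddfMn.
have := @contraction_star A (n * n) d.
rewrite Ed !complete_square muln_gt0 n0 starK => /(_ isT) dP.
by apply: (@positiveMn_inv _ 2) => //; apply: dP; rewrite mulr2n; exact: positiveD.
Qed.

(** * Consequences of pointedness and properness *)

Lemma sum_squares_eq0 (A : starRingType) (s : seq A) (x : A) :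
  proper_star A ->
  sums_of_squares A `&` opp_set (sums_of_squares A) = [set 0] ->
  \sum_(z <- s) star z * z = 0 -> x \in s -> x = 0.
Proof.
move=> A_proper A_pointed s0 xs; apply: A_proper.
suff : (sums_of_squares A `&` opp_set (sums_of_squares A)) (star x * x).
  by rewrite A_pointed.
split; first exact: square_sums_of_squares.
exists (\sum_(z <- rem x s) star z * z).
  by apply/sums_of_squaresP; exists (rem x s).
by move: s0; rewrite (big_rem x) //= addrC => /eqP; rewrite addr_eq0 => /eqP ->; rewrite opprK.
Qed.

(** If [n] copies of [a] sum to zero, so do [n] copies of the square of [a]. *)
Lemma mulrn_eq0_pointed (A : starRingType) n (a : A) :
  proper_star A ->
  sums_of_squares A `&` opp_set (sums_of_squares A) = [set 0] ->
  (0 < n)%N -> a *+ n = 0 -> a = 0.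
Proof.
move=> A_proper A_pointed n0 an0.
apply: (@sum_squares_eq0 _ (nseq n a)) => //; last by rewrite mem_nseq n0 eqxx.
by rewrite big_nseq iter_addr addr0 -mulrnAr an0 mulr0.
Qed.

Lemma positive_star (A : starRingType) (a : A) :
  proper_star A ->
  sums_of_squares A `&` opp_set (sums_of_squares A) = [set 0] ->
  positive_elts A a -> star a = a.
Proof.
move=> A_proper A_pointed [n [n0 /sums_of_squaresP[s Es]]].
apply/eqP; rewrite -subr_eq0; apply/eqP.
apply: (@mulrn_eq0_pointed _ n) => //.
rewrite mulrnBl -(raddfMn (@star A)) /= Es raddf_sum /=.
by under eq_bigr do rewrite starM starK; rewrite subrr.
Qed.

(** * Elements detected by their quadratic form *)

(** The conclusion on [star b] makes [star (b * w) * y = star w * (star b * y)]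
    vanish for every [w], which is how the zero of one form yields a zero of
    another. *)
Definition form_definite (A : starRingType) (b : A) : Prop :=
  forall y, star y * b * y = 0 -> b * y = 0 /\ star b * y = 0.

Lemma positive_form_definite (A : starRingType) (a : A) :
  proper_star A ->
  sums_of_squares A `&` opp_set (sums_of_squares A) = [set 0] ->
  positive_elts A a -> form_definite A a.
Proof.
move=> A_proper A_pointed Pa y yay0.
suff ay0 : a * y = 0 by rewrite positive_star.
case: Pa => n [n0 /sums_of_squaresP[s Es]].
apply: (@mulrn_eq0_pointed _ n) => //.
rewrite -mulrnAl Es mulr_suml big_seq big1 // => x xs.
rewrite -mulrA (_ : x * y = 0) ?mulr0 //.
apply: (@sum_squares_eq0 _ [seq z * y | z <- s]) => //; last exact: map_f.
by rewrite big_map -conj_sum_squares -Es mulrnAr mulrnAl yay0 mul0rn.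
Qed.

(** At a zero [y] of the form of [b], conjugating the defining inequality by
    [y] makes minus twice the square of [b * y] positive. *)
Lemma cone_form_eq0 (A : starRingType) (b y : A) :
  proper_star A ->
  sums_of_squares A `&` opp_set (sums_of_squares A) = [set 0] ->
  cone_elts A b -> star y * b * y = 0 -> b * y = 0.
Proof.
move=> A_proper A_pointed /coneP[n [n0 /(@positive_conj _ _ y)]] + yby0.
have ybsy0 : star y * star b * y = 0.
  by rewrite -star_form yby0 raddf0.
rewrite mulrBr mulrBl mulrnAr mulrnAl mulrDr mulrDl yby0 ybsy0 addr0 mul0rn.
rewrite sub0r mulrnAr mulrnAl [star y * (_ * _)]mulrA -starM -mulrA.
move=> [m [m0 /sums_of_squaresP[s Es]]].
apply: (@sum_squares_eq0 _ (nseq (2 * m) (b * y) ++ s)) => //.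
  by rewrite big_cat big_nseq iter_addr addr0 /= -Es mulNrn -mulrnA subrr.
by rewrite mem_cat mem_nseq muln_gt0 m0 eqxx.
Qed.

Lemma cone_form_definite (A : starRingType) (b : A) :
  proper_star A ->
  sums_of_squares A `&` opp_set (sums_of_squares A) = [set 0] ->
  cone_elts A b -> form_definite A b.
Proof.
move=> A_proper A_pointed Cb y yby0; split; first exact: cone_form_eq0.
apply: cone_form_eq0 => //; first exact: cone_star.
by rewrite -star_form yby0 raddf0.
Qed.

(** * Elements whose square has the same kernel *)

Lemma nilpotent_eq0 (A : starRingType) (x : A) :
  (forall y, x * (x * y) = 0 -> x * y = 0) -> nilpotent_elt x -> x = 0.
Proof.
move=> xK [[|m] [//= _]]; elim: m => [|m IHm]; first by rewrite expr1.
by rewrite !exprS => /xK; rewrite -exprS.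
Qed.

Lemma form_definite_mul_kernel (A : starRingType) (b c y : A) :
  form_definite A b -> form_definite A c ->
  b * c * (b * c * y) = 0 -> b * c * y = 0.
Proof.
rewrite -!mulrA => Db Dc H.
have /Db[_ bs0] : star (c * (b * (c * y))) * b * (c * (b * (c * y))) = 0.
  by rewrite -mulrA H mulr0.
have /Dc[_ cs0] : star (b * (c * y)) * c * (b * (c * y)) = 0.
  by rewrite starM -!mulrA bs0 mulr0.
have /Db[] // : star (c * y) * b * (c * y) = 0.
by rewrite starM -!mulrA cs0 mulr0.
Qed.

(** For normal [a] the elements [star a * z] and [a * z] have the same square,
    so [star a * a * y] vanishes together with [a * a * y]. *)
Lemma normal_kernel (A : starRingType) (a y : A) :
  proper_star A -> normal_elts A a -> a * (a * y) = 0 -> a * y = 0.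
Proof.
move=> A_proper Na aay0.
have saay0 : star a * (a * y) = 0.
  apply: A_proper.
  rewrite starM starK -mulrA [a * (star a * _)]mulrA Na.
  by rewrite -[star a * a * _]mulrA aay0 !mulr0.
by apply: A_proper; rewrite starM -mulrA saay0 mulr0.
Qed.

Theorem corollary2 (A : starRingType) (A_proper : proper_star A)
  (A_pointed : sums_of_squares A `&` opp_set (sums_of_squares A) = [set 0]) :
  ~ exists x : A,
      [/\ x != 0, nilpotent_elt x &
          (mul_set (cone_elts A `|` positive_elts A)
                   (cone_elts A `|` positive_elts A)
           `|` normal_elts A) x].
Proof.
have definite b : (cone_elts A `|` positive_elts A) b -> form_definite A b.
  by case; [exact: cone_form_definite | exact: positive_form_definite].
move=> [x [/eqP x0 nilx Hx]]; apply: x0; apply: nilpotent_eq0 nilx => y.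
case: Hx => [[b Hb [c Hc <-]]|Nx]; last exact: normal_kernel.
by apply: form_definite_mul_kernel; exact: definite.
Qed.
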